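(* Let $P \subseteq \mathbb{Z}^m$ be a rectangle, and let $R_1, R_2$ be rectangles in $\mathbb{Z}^m$ with $\mathbf{0} \in R_1 \subseteq R_2$. Then $R_1 \subseteq_{S,P} R_2$.
   Context: A rectangle in $\mathbb{Z}^m$ is a set of the form $\mathbb{Z}^m \cap \prod_{i=1}^m [a_i, b_i]$ with integers $a_i \leq b_i$. For a pixel set $P \subseteq \mathbb{Z}^m$ and finite sets $B_1, B_2 \subseteq \mathbb{Z}^m$ containing $\mathbf{0}$ (structuring elements), $B_1 \subseteq_{S,P} B_2$ means $B_1 \subseteq B_2$ and both: (+) for every $\mathbf{x} \in P$ and $\mathbf{b}_2 \in B_2$ with $\mathbf{x} + \mathbf{b}_2 \in P$ there is $\mathbf{b}_1 \in B_1$ with $\mathbf{x} + \mathbf{b}_1 \in P$ and $B_1 + (\mathbf{b}_2 - \mathbf{b}_1) \subseteq B_2$; (−) for every $\mathbf{x} \in P$ and $\mathbf{b}_2 \in B_2$ with $\mathbf{x} - \mathbf{b}_2 \in P$ there is $\mathbf{b}_1 \in B_1$ with $\mathbf{x} - \mathbf{b}_1 \in P$ and $B_1 + (\mathbf{b}_2 - \mathbf{b}_1) \subseteq B_2$. Here $A + \mathbf{v} = \{\mathbf{a} + \mathbf{v} : \mathbf{a} \in A\}$. *)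

(* Defs.v *)
From mathcomp Require Import all_boot all_order all_algebra.
From mathcomp Require Import boolp classical_sets functions cardinality.

Set Implicit Arguments.
Unset Strict Implicit.
Unset Printing Implicit Defensive.

Import Order.TTheory GRing.Theory Num.Theory.
Local Open Scope classical_set_scope.
Local Open Scope ring_scope.

(* Points of Z^m are integer row vectors; [x 0 i] is the i-th coordinate. *)

Definition rectangle (m : nat) (A : set 'rV[int]_m) : Prop :=
  exists a b : 'rV[int]_m,
    (forall i : 'I_m, a 0 i <= b 0 i) /\
    A = [set x | forall i : 'I_m, a 0 i <= x 0 i <= b 0 i].

Definition structuring_element (m : nat) (B : set 'rV[int]_m) : Prop :=
  finite_set B /\ B 0.

Definition translate (m : nat) (A : set 'rV[int]_m) (v : 'rV[int]_m) :
    set 'rV[int]_m :=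
  [set a + v | a in A].

(* The relation is meaningful only between structuring elements, so it
   includes the requirement that both of its arguments are such. *)
Definition subset_SP (m : nat) (P B1 B2 : set 'rV[int]_m) : Prop :=
  [/\ structuring_element B1 /\ structuring_element B2,
      B1 `<=` B2,
      forall x b2 : 'rV[int]_m, P x -> B2 b2 -> P (x + b2) ->
        exists b1 : 'rV[int]_m,
          [/\ B1 b1, P (x + b1) & translate B1 (b2 - b1) `<=` B2]
    & forall x b2 : 'rV[int]_m, P x -> B2 b2 -> P (x - b2) ->
        exists b1 : 'rV[int]_m,
          [/\ B1 b1, P (x - b1) & translate B1 (b2 - b1) `<=` B2]].

(* Main.v *)
(** Everything happens coordinatewise, so think of intervals.  Take for [b1] the
    point of [R1] nearest to [b2].  Since [R1] contains 0, this [b1] lies between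
    0 and [b2], so [x + b1] and [x - b1] stay in the convex set [P].  If
    [b2] is not in [R1], then [b1] is an endpoint of [R1], which the translation
    by [b2 - b1] moves exactly to [b2], hence [R1] stays inside [R2]. *)

Require Import Defs.
From mathcomp Require Import all_boot all_order all_algebra.
From mathcomp Require Import boolp classical_sets functions cardinality.
From mathcomp Require Import zify.
Import Order.TTheory GRing.Theory Num.Theory.
Local Open Scope classical_set_scope.
Local Open Scope ring_scope.

Lemma rectangle_finite (m : nat) (A : set 'rV[int]_m) :
  rectangle A -> finite_set A.
Proof.
move=> [a [b [_ ->]]].
(* The sum of all side lengths bounds each of them, so every offset from the corner [a] fits into
   the single finite type ['I_N.+1]. *)
pose N := (\sum_(i < m) absz (b 0 i - a 0 i)%R)%N.
pose f (u : {ffun 'I_m -> 'I_N.+1}) : 'rV[int]_m :=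
  \row_i (a 0 i + (u i : nat)%:Z).
apply: (@sub_finite_set _ _ (f @` setT)); last exact/finite_image/finite_finset.
move=> x /= hx; exists [ffun i => inord (absz (x 0 i - a 0 i)%R)] => //.
apply/rowP => i; rewrite !mxE ffunE inordK; first by have := hx i; lia.
have : (absz (b 0 i - a 0 i)%R <= N)%N by rewrite /N (bigD1 i) //= leq_addr.
by have := hx i; lia.
Qed.

(** The point [b1] depends on neither [P] nor [x], so one choice serves both sign conditions of
    [subset_SP]. *)
Lemma rectangle_nearest_point (m : nat) (R1 R2 : set 'rV[int]_m)
    (hR1 : rectangle R1) (hR2 : rectangle R2) (h0 : R1 0) (hR12 : R1 `<=` R2)
    (b2 : 'rV[int]_m) (hb2 : R2 b2) :
  exists b1 : 'rV[int]_m,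
    [/\ R1 b1,
        forall i, (0 <= b1 0 i <= b2 0 i) || (b2 0 i <= b1 0 i <= 0)
      & translate R1 (b2 - b1) `<=` R2].
Proof.
case: hR1 h0 hR12 => [c [d [lecd ->]]] h0 hR12.
case: hR2 hb2 hR12 => [e [f [_ ->]]] /= hb2 hR12.
(* The corners [c] and [d] lie in [R1], which turns the inclusion into inequalities between
   endpoints. *)
have hc : forall i, e 0 i <= c 0 i <= f 0 i.
  by apply: hR12 => i /=; rewrite lexx lecd.
have hd : forall i, e 0 i <= d 0 i <= f 0 i.
  by apply: hR12 => i /=; rewrite lexx lecd.
have h0' i : c 0 i <= 0 <= d 0 i by have := h0 i; rewrite mxE.
exists (\row_i Num.max (c 0 i) (Num.min (b2 0 i) (d 0 i))); split.
- by move=> i; rewrite mxE; have := lecd i; lia.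
- by move=> i; rewrite mxE; have := h0' i; lia.
(* Where [b2] exceeds [d], the shift is positive: the lower end stays at least [e] and the upper end
   lands on [b2]. Below [c] is symmetric; otherwise the shift is zero. *)
- move=> _ [u /= hu <-] i; rewrite !mxE.
  move: (hu i) (hb2 i) (hc i) (hd i).
  by move: (u 0 i) (b2 0 i) (c 0 i) (d 0 i) (e 0 i) (f 0 i) => *; lia.
Qed.

Theorem theorem1 (m : nat) (P R1 R2 : set 'rV[int]_m)
    (hP : rectangle P) (hR1 : rectangle R1) (hR2 : rectangle R2)
    (h0 : R1 0) (hR12 : R1 `<=` R2) :
  subset_SP P R1 R2.
Proof.
have nearest := @rectangle_nearest_point _ _ _ hR1 hR2 h0 hR12.
split => //.
- by split; split; [exact: rectangle_finite | | exact: rectangle_finite | exact: hR12].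
- move=> x b2 Px /nearest[b1 [R1b1 between sub]] Pxb2; exists b1; split=> //.
  case: hP Px Pxb2 => [p [q [_ ->]]] /= Px Pxb2 i; rewrite !mxE.
  move: (Px i) (Pxb2 i) (between i); rewrite !mxE.
  by move: (x 0 i) (b1 0 i) (b2 0 i) (p 0 i) (q 0 i) => *; lia.
- move=> x b2 Px /nearest[b1 [R1b1 between sub]] Pxb2; exists b1; split=> //.
  case: hP Px Pxb2 => [p [q [_ ->]]] /= Px Pxb2 i; rewrite !mxE.
  move: (Px i) (Pxb2 i) (between i); rewrite !mxE.
  by move: (x 0 i) (b1 0 i) (b2 0 i) (p 0 i) (q 0 i) => *; lia.
Qed.
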